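(* Let $x\ge\frac12$ and let $\mathcal{P}_x$ be the set of all perfect-packing distributions whose maximum item size is at most $x$. Then \[ \inf_{F\in\mathcal{P}_x}\mathrm{AECR}(\mathrm{DNF},F)\ \ge\ \frac{1}{1+x^2+(1-x)^2}. \]
   Context: Bin covering: for a list $L$ of item sizes in $[0,1]$, a bin is covered if its total size is at least $1$; $\mathrm{OPT}(L)$ is the maximum number of pairwise disjoint sets of items of $L$ each of total size at least $1$, and $s(L)$ is the total size. Dual Next-Fit ($\mathrm{DNF}$) processes the items in order, putting every item into a single current bin; as soon as the current bin has total size at least $1$ it is counted as covered and a new empty current bin is started; $\mathrm{DNF}(L)$ is the number of covered bins. A discrete distribution $F$ is given by non-negative rational item sizes $(s_1,\ldots,s_m)$ and positive rational probabilities $(p_1,\ldots,p_m)$ summing to $1$ (its maximum item size is $\max_i s_i$); $I_n(F)$ is a list of $n$ i.i.d. items drawn from $F$. $F$ is a perfect-packing distribution if $\mathbb{E}[s(I_n(F))-\mathrm{OPT}(I_n(F))]=o(n)$. $\mathrm{AECR}(\mathrm{DNF},F)=\liminf_{n\to\infty}\mathbb{E}[\mathrm{DNF}(I_n(F))]/\mathbb{E}[\mathrm{OPT}(I_n(F))]$. *)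

(* Defs.v *)
From HB Require Import structures.
From mathcomp Require Import all_boot all_order all_algebra.
From mathcomp Require Import all_classical all_reals all_analysis.

Set Implicit Arguments.
Unset Strict Implicit.
Unset Printing Implicit Defensive.

Import Order.TTheory GRing.Theory Num.Theory.
Import numFieldNormedType.Exports.

Local Open Scope classical_set_scope.
Local Open Scope ring_scope.

Definition total_size (L : seq rat) : rat := \sum_(a <- L) a.

(* Items are identified with their positions in [L], so that repeated sizes
   count as distinct items.  A set of total size at least 1 is nonempty, so
   disjoint members of a covering family are distinct and [#|P|] counts bins. *)
Definition covering_family (L : seq rat) (P : {set {set 'I_(size L)}}) : bool :=
  finset.trivIset P && [forall B in P, 1 <= \sum_(i in B) L`_i].

Definition opt (L : seq rat) : nat :=
  \max_(P : {set {set 'I_(size L)}} | covering_family P) #|P|.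

Fixpoint dnf_from (level : rat) (L : seq rat) : nat :=
  if L is a :: L' then
    if 1 <= level + a then (dnf_from 0 L').+1 else dnf_from (level + a) L'
  else 0%N.

Definition dnf (L : seq rat) : nat := dnf_from 0 L.

Record discrete_distribution := DiscreteDistribution {
  nitems : nat;
  item_size : 'I_nitems -> rat;
  item_prob : 'I_nitems -> rat;
  item_size_itv : forall i, 0 <= item_size i <= 1;
  item_prob_gt0 : forall i, 0 < item_prob i;
  item_prob_sum1 : \sum_i item_prob i = 1 }.

(* The sizes are nonnegative and there is at least one of them, so the initial
   value 0 of the iterated maximum is harmless. *)
Definition max_item_size (F : discrete_distribution) : rat :=
  \big[Num.max/0]_(i < nitems F) item_size i.

(* The expectation of [f (I_n(F))]: the law of the [n] i.i.d. draws is the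
   product law on the [n]-tuples of indices. *)
Definition expect (R : realType) (F : discrete_distribution) (n : nat)
    (f : seq rat -> R) : R :=
  \sum_(w : n.-tuple 'I_(nitems F))
    (\prod_(j < n) ratr (item_prob (tnth w j)))
      * f [seq item_size i | i <- w].

Definition perfect_packing (R : realType) (F : discrete_distribution) : Prop :=
  (fun n : nat => expect F n (fun L => ratr (total_size L) - (opt L)%:R) : R^o)
    =o_\oo (fun n : nat => n%:R : R^o).

(* [opt L = 0] forces [dnf L = 0], so the first branch only covers 0/0.  It is
   taken for infinitely many [n] only if all item sizes are 0, in which case
   the informal ratio is undefined and is set to 1 here. *)
Definition expected_ratio (R : realType) (F : discrete_distribution)
    (n : nat) : R :=
  let e_opt := expect F n (fun L => (opt L)%:R) in
  if e_opt == 0 then 1 else expect F n (fun L => (dnf L)%:R) / e_opt.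

Definition aecr_dnf (R : realType) (F : discrete_distribution) : \bar R :=
  limn_einf (fun n => (expected_ratio R F n)%:E).

Definition perfect_packing_upto (R : realType) (x : R) :
    set discrete_distribution :=
  [set F | perfect_packing R F /\ ratr (max_item_size F) <= x].

(* Main.v *)
(** In the DNF packing, a bin is a renewal process with the law of an item
    size X, stopped when it reaches 1.  If M is the mean number of items per
    bin, then E[DNF(I_n)] >= n/M - 1, while OPT(L) <= s(L) gives
    E[OPT(I_n)] <= n E[X], so the ratio is asymptotically at least
    1/(M E[X]) = 1/(1 + E[overshoot]).  Lorden's inequality bounds the mean
    overshoot by E[X^2]/E[X]; its proof (Carlsson and Nerman) compares the
    subadditivity of the mean overshoot r(t), which gives
    t r(t) <= 2 (r(1) + ... + r(t)), with the exact value of this sum.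

    Finally, if items of size at most x fill a bin to total size S >= 1, their
    squares sum to at most x^2 + (1-x)^2 + 2 (S - 1).  Summed over an optimal
    covering, the excess is of the order of s(L) - OPT(L), hence o(n) for
    perfect packing, and E[X^2] <= (x^2 + (1-x)^2) E[X]. *)

Require Import Defs.
From HB Require Import structures.
From mathcomp Require Import all_boot all_order all_algebra.
From mathcomp Require Import all_classical all_reals all_analysis.
From mathcomp Require Import ring lra zify.

Set Implicit Arguments.
Unset Strict Implicit.
Unset Printing Implicit Defensive.

Import Order.TTheory GRing.Theory Num.Theory.
Import numFieldNormedType.Exports.

Local Open Scope classical_set_scope.
Local Open Scope ring_scope.

(** * Renewal theory for steps [k i] in [nat], up to Lorden's inequality *)

Section Renewal.

Context (R : realFieldType) (I : finType) (p : I -> R) (k : I -> nat).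
Hypothesis p_ge0 : forall i, 0 <= p i.
Hypothesis p_sum1 : \sum_i p i = 1.
Hypothesis p_step_gt0 : 0 < \sum_(i | k i != 0%N) p i.

(** A minimum principle: zero steps have total probability below 1, so their share of [H t] moves to
    the right and strong induction handles the rest. Truncated subtraction makes 0 the absorbing
    state. *)
Lemma superharmonic_ge0 (H : nat -> R) :
  0 <= H 0%N ->
  (forall t, (0 < t)%N -> \sum_i p i * H (t - k i)%N <= H t) ->
  forall t, 0 <= H t.
Proof.
move=> H0 Hsup; elim/ltn_ind=> -[//|t] IH.
have := Hsup t.+1 isT.
rewrite (bigID (fun i => k i != 0%N)) /=.
have -> : \sum_(i | ~~ (k i != 0%N)) p i * H (t.+1 - k i)%N
    = (\sum_(i | ~~ (k i != 0%N)) p i) * H t.+1.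
  by rewrite mulr_suml; apply: eq_bigr => i; rewrite negbK => /eqP ->; rewrite subn0.
have : 0 <= \sum_(i | k i != 0%N) p i * H (t.+1 - k i)%N.
  apply: sumr_ge0 => i ki; apply: mulr_ge0 => //; apply: IH; lia.
have := p_sum1; rewrite (bigID (fun i => k i != 0%N)) /=.
set a := \sum_(i | k i != 0%N) p i; set b := \sum_(i | ~~ _) p i.
move=> ab1 s_ge0 le_t; rewrite -(pmulr_rge0 _ p_step_gt0) -/a.
have -> : a = 1 - b by lra.
lra.
Qed.

(* The fuel [n] only makes the recursion structural. *)
Fixpoint renewal_fuel (n t : nat) : R :=
  if n isn't n'.+1 then 0 else
  if t == 0%N then 0 else
  (1 + \sum_(i | k i != 0%N) p i * renewal_fuel n' (t - k i)%N)
    / \sum_(i | k i != 0%N) p i.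

(* Mean number of draws until their sum is at least [t]. *)
Definition renewal (t : nat) : R := renewal_fuel t t.

Lemma renewal_fuelE n t : (t <= n)%N -> renewal_fuel n t = renewal t.
Proof.
rewrite /renewal; elim/ltn_ind: n t => -[|n] IH [|t] // tn.
rewrite /=; congr (_ / _); congr (1 + _); apply: eq_bigr => i ki; congr (_ * _).
by rewrite (IH n) ?(IH t) //; lia.
Qed.

Lemma renewal0 : renewal 0 = 0. Proof. by []. Qed.

(** The recursion is this equation solved for [renewal t], which zero steps bring to both sides;
    hence its denominator. *)
Lemma renewalE t : (0 < t)%N -> renewal t = 1 + \sum_i p i * renewal (t - k i)%N.
Proof.
case: t => // t _.
have rE : renewal t.+1 = (1 + \sum_(i | k i != 0%N) p i * renewal (t.+1 - k i)%N)
    / \sum_(i | k i != 0%N) p i.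
  rewrite {1}/renewal /=; congr (_ / _); congr (1 + _); apply: eq_bigr => i ki.
  by rewrite renewal_fuelE //; lia.
rewrite (bigID (fun i => k i != 0%N)) /=.
have -> : \sum_(i | ~~ (k i != 0%N)) p i * renewal (t.+1 - k i)%N
    = (\sum_(i | ~~ (k i != 0%N)) p i) * renewal t.+1.
  by rewrite mulr_suml; apply: eq_bigr => i; rewrite negbK => /eqP ->; rewrite subn0.
have := p_sum1; rewrite (bigID (fun i => k i != 0%N)) /=.
move: rE; set a := \sum_(i | k i != 0%N) p i; set b := \sum_(i | ~~ _) p i.
move=> rE ab1; have a0 : a != 0 by rewrite gt_eqF.
have -> : b = 1 - a by lra.
rewrite rE; field.
exact: a0.
Qed.

Lemma renewal_ge0 t : 0 <= renewal t.
Proof.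
apply: superharmonic_ge0 => // {}t t0.
by rewrite (renewalE t0) lerDr.
Qed.

Lemma renewal_nondecreasing s t : (s <= t)%N -> renewal s <= renewal t.
Proof.
apply: (homo_leq (@lexx _ _) (@le_trans _ _)) => {s t} t.
(* The increment becomes a function of the single index [t.+1], extended by 0 at index 0 since
   [0.-1] is 0, so that the minimum principle applies. *)
rewrite -subr_ge0 -[X in renewal _ - renewal X]/(t.+1.-1).
move: t.+1 => {}t; move: t.
apply: superharmonic_ge0 => [|[|[|t]] // _] /=.
- by rewrite subrr.
- rewrite [X in _ <= X - _]renewalE //= subr0.
  under eq_bigr => i _.
    rewrite (_ : renewal (1 - k i).-1 = 0) ?subr0; last by case: (k i) => [|[]].
    over.
  by rewrite lerDr.
rewrite [X in _ <= X - _]renewalE // [X in _ <= _ - X]renewalE //=.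
rewrite opprD addrACA subrr add0r -sumrB; apply: ler_sum => i _.
by rewrite -mulrBr; suff -> : ((t.+2 - k i).-1 = t.+1 - k i)%N by []; lia.
Qed.

Lemma renewal_subadditive s t : renewal (s + t) <= renewal s + renewal t.
Proof.
rewrite -subr_ge0; move: t.
apply: superharmonic_ge0 => [|t t0]; first by rewrite addn0 renewal0 addr0 subrr.
rewrite [X in _ <= _ + X - _]renewalE // [X in _ <= _ - X]renewalE; last by lia.
(* A draw exceeding [t] takes [s + t - k i] below [s], whereas [s + (t - k i)] stays at [s];
   monotonicity covers this case. *)
apply: (@le_trans _ _ (\sum_i (p i * renewal s + p i * renewal (t - k i)
    - p i * renewal (s + t - k i)))).
  apply: ler_sum => i _; rewrite -mulrDr -mulrBr; apply: ler_wpM2l => //.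
  by rewrite lerD2l lerN2; apply: renewal_nondecreasing; lia.
rewrite sumrB big_split /= -mulr_suml p_sum1 mul1r.
lra.
Qed.

Let mean : R := \sum_i p i * (k i)%:R.
Let second_moment : R := \sum_i p i * (k i)%:R ^+ 2.

(* By Wald's identity, this is the mean overshoot above [t]. *)
Definition overshoot (t : nat) : R := mean * renewal t - t%:R.

Lemma overshoot0 : overshoot 0 = 0.
Proof. by rewrite /overshoot renewal0 mulr0 subr0. Qed.

(** Condition on the first draw: it passes [t] by [k i - t] or leaves [t - k i] to go. At least one
    truncated difference is 0, and [overshoot 0] is 0. *)
Lemma overshootE t : (0 < t)%N ->
  overshoot t = \sum_i p i * ((k i - t)%:R + overshoot (t - k i)%N).
Proof.
move=> t0; rewrite {1}/overshoot renewalE // mulrDr mulr1 mulr_sumr.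
rewrite -[t%:R]mul1r -[X in X * t%:R]p_sum1 mulr_suml {1}/mean -big_split /= -sumrB.
apply: eq_bigr => i _; rewrite /overshoot -/mean.
have : (k i)%:R + (t - k i)%:R = t%:R + (k i - t)%:R :> R.
  by rewrite -!natrD; congr (_%:R); lia.
move=> /(canRL (addrK _)) ->.
move: (k i - t)%:R (t - k i)%:R (renewal _) => a b m; ring.
Qed.

Lemma overshoot_subadditive s t : 0 <= mean ->
  overshoot (s + t) <= overshoot s + overshoot t.
Proof.
move=> mean_ge0; have := ler_wpM2l mean_ge0 (renewal_subadditive s t).
rewrite /overshoot natrD; lra.
Qed.

(** Twice the sum is [j ^ 2 - j] minus the same expression in [j - t]; the terms are arranged to
    avoid further truncated subtractions. *)
Lemma sum_subn j t :
  (2 * (\sum_(1 <= s < t.+1) (j - s)) + (j - t) ^ 2 + j = j ^ 2 + (j - t))%N.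
Proof.
elim: t => [|t IH]; first by rewrite big_geq // subn0; lia.
rewrite big_nat_recr //=; nia.
Qed.

Lemma sum_overshoot_subn j t :
  \sum_(1 <= s < t.+1) overshoot (s - j) = \sum_(1 <= s < (t - j).+1) overshoot s.
Proof.
elim: t => [|t IH]; first by rewrite !big_geq.
rewrite big_nat_recr //= IH; case: (leqP j t) => jt.
  by rewrite subSn // [in RHS]big_nat_recr.
have [-> ->] : (t - j = 0)%N /\ (t.+1 - j = 0)%N by lia.
by rewrite overshoot0 addr0.
Qed.

Lemma jensen_sqr (y : I -> R) :
  (\sum_i p i * y i) ^+ 2 <= \sum_i p i * y i ^+ 2.
Proof.
set e := \sum_i p i * y i.
have : 0 <= \sum_i p i * (y i - e) ^+ 2.
  by apply: sumr_ge0 => i _; rewrite mulr_ge0 // sqr_ge0.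
have -> : \sum_i p i * (y i - e) ^+ 2
    = \sum_i (p i * y i ^+ 2 - 2 * e * (p i * y i) + p i * e ^+ 2).
  by apply: eq_bigr => i _; ring.
rewrite big_split sumrB /= -mulr_sumr -mulr_suml p_sum1 -/e; lra.
Qed.

(* With [R_s] the overshoot above [s], a draw that moves the sum from [S] to
   [S + j] contributes [(j - 1) + ... + 0] to the sum of the [R_s]; hence the
   right-hand side is the second moment of [R_t]. *)
Lemma sqr_overshoot_le t :
  overshoot t ^+ 2 <= (second_moment - mean) * renewal t
    - 2 * (\sum_(1 <= s < t.+1) overshoot s) + overshoot t.
Proof.
set A := fun t => \sum_(1 <= s < t.+1) overshoot s.
rewrite -/(A t) -subr_ge0; move: t.
apply: superharmonic_ge0 => [|t t0].
  by rewrite /A big_geq // renewal0 overshoot0; lra.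
have mE := renewalE t0.
have rE := overshootE t0.
have AE : A t = \sum_i p i * ((\sum_(1 <= s < t.+1) (k i - s))%:R + A (t - k i)%N).
  rewrite /A big_nat_cond.
  under eq_bigr => s /andP[/andP[s0 _] _] do rewrite overshootE //.
  rewrite -big_nat_cond exchange_big /=; apply: eq_bigr => i _.
  by rewrite -mulr_sumr big_split /= sum_overshoot_subn natr_sum.
(* Jensen over the first draw; the cross term vanishes because one of the two summands is 0. *)
have rr : overshoot t ^+ 2
    <= \sum_i p i * ((k i - t)%:R ^+ 2 + overshoot (t - k i) ^+ 2).
  rewrite rE; apply: (le_trans (jensen_sqr _)); apply: ler_sum => i _.
  apply: ler_wpM2l => //; have [->|->] : (k i - t = 0)%N \/ (t - k i = 0)%N by lia.
    by rewrite !add0r expr0n add0r.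
  by rewrite overshoot0 !addr0 expr0n addr0.
(* By this identity, the source terms of the linear part of the bound add up to the mean of
   [(k i - t)%:R ^+ 2], the source term in [rr]. *)
have momE : 2 * (\sum_i p i * (\sum_(1 <= s < t.+1) (k i - s))%:R)
    + (\sum_i p i * (k i - t)%:R ^+ 2) + mean
    = second_moment + \sum_i p i * (k i - t)%:R.
  rewrite mulr_sumr -!big_split /=; apply: eq_bigr => i _.
  have := congr1 (fun n => n%:R : R) (sum_subn (k i) t).
  rewrite !natrD natrM !natrX => e.
  rewrite -mulrDr -e; ring.
have splitE (f g : I -> R) :
    \sum_i p i * (f i + g i) = (\sum_i p i * f i) + \sum_i p i * g i.
  by rewrite -big_split; apply: eq_bigr => i _; rewrite mulrDr.
rewrite splitE in AE; rewrite splitE in rE; rewrite splitE in rr.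
have -> : \sum_i p i * ((second_moment - mean) * renewal (t - k i)
      - 2 * A (t - k i)%N + overshoot (t - k i) - overshoot (t - k i) ^+ 2)
    = (second_moment - mean) * (\sum_i p i * renewal (t - k i))
      - 2 * (\sum_i p i * A (t - k i)%N) + (\sum_i p i * overshoot (t - k i))
      - \sum_i p i * overshoot (t - k i) ^+ 2.
  rewrite !mulr_sumr -!sumrB -big_split -sumrB /=.
  by apply: eq_bigr => i _; ring.
rewrite mE AE [X in _ <= _ + X - _]rE mulrDr mulr1; lra.
Qed.

Lemma lorden t : (0 < t)%N -> 0 < mean -> overshoot t <= second_moment / mean.
Proof.
move=> t0 mean_gt0; rewrite ler_pdivlMr //.
(* Pair [s] with [t - s] for the [t.+1] values of [s] from 0 to [t]. *)
have sub2 : (t.+1)%:R * overshoot t <= 2 * \sum_(1 <= s < t.+1) overshoot s.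
  have -> : 2 * (\sum_(1 <= s < t.+1) overshoot s)
      = \sum_(0 <= s < t.+1) (overshoot s + overshoot (t - s)).
    rewrite [RHS]big_split /=.
    have -> : \sum_(0 <= s < t.+1) overshoot (t - s) = \sum_(0 <= s < t.+1) overshoot s.
      by rewrite big_nat_rev; apply: eq_big_nat => s ?; congr overshoot; lia.
    by rewrite (big_ltn (ltn0Sn t)) overshoot0 add0r; ring.
  rewrite mulr_natl -[in leLHS](subn0 t.+1) -sumr_const_nat.
  apply: ler_sum_nat => s /andP[_ st].
  rewrite -{1}(subnKC (ltnSE st)); apply: overshoot_subadditive; exact: ltW.
have le2 := sqr_overshoot_le t.
have rE : mean * renewal t = t%:R + overshoot t by rewrite /overshoot; ring.
have r_gt0 : 0 < renewal t.
  rewrite renewalE //; apply: ltr_wpDr => //.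
  by apply: sumr_ge0 => i _; rewrite mulr_ge0 ?renewal_ge0.
(* Since [mean * renewal t] is [t%:R + overshoot t], [sub2] and [le2] combine so that the factor
   [renewal t] cancels. *)
have : overshoot t * (mean * renewal t) <= (second_moment - mean) * renewal t.
  rewrite rE; have := ler0n R t; rewrite -natr1 in sub2; nra.
rewrite mulrA ler_pM2r //; lra.
Qed.

End Renewal.

(** * Weight bounds for optimal coverings *)

(** Disjoint bins carry weight at least [K] each, and the items left over have nonnegative
    weight. *)
Lemma opt_mul_le (R : realType) (L : seq rat) (K : R) (phi : rat -> R) :
  (forall a, a \in L -> 0 <= phi a) ->
  (forall B : {set 'I_(size L)}, 1 <= \sum_(i in B) L`_i ->
    K <= \sum_(i in B) phi L`_i) ->
  (opt L)%:R * K <= \sum_(a <- L) phi a.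
Proof.
move=> phi_ge0 phi_bin.
have sum_ge0 : 0 <= \sum_(a <- L) phi a.
  by rewrite big_seq; apply: sumr_ge0.
rewrite /opt; elim/big_ind: _ => [|m n mP nP|P].
- by rewrite mul0r.
- by case: (leqP m n).
case/andP=> tiP /'forall_implyP covP.
rewrite (big_nth 0) big_mkord mulr_natl -sumr_const.
have {}covP B : B \in P -> K <= \sum_(i in B) phi L`_i.
  by move=> BP; apply: phi_bin; apply: covP.
apply: (le_trans (ler_sum _ covP)).
rewrite -(finset.big_trivIset _ tiP) /= [leRHS](bigID (mem (finset.cover P))) /=.
by rewrite lerDl; apply: sumr_ge0 => i _; apply/phi_ge0/mem_nth.
Qed.

Lemma opt_le_total_size (R : realType) (L : seq rat) :
  (forall a, a \in L -> 0 <= a) -> (opt L)%:R <= ratr (total_size L) :> R.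
Proof.
move=> L_ge0; rewrite -[leLHS]mulr1 /total_size rmorph_sum.
apply: opt_mul_le => [a aL|B B1]; first by rewrite ler0q L_ge0.
by rewrite -rmorph_sum /= -[1](rmorph1 (@ratr R)) ler_rat.
Qed.

(** The extreme bin holds [x] and [1 - x]. If all items are at most 1/2, the squares sum to at most
    half the total; otherwise one item [z] exceeds 1/2 and the others, of total [u], have squares
    summing to at most [u ^+ 2] and also to at most [u]. *)
Lemma sum_sqr_le_covered (R : realType) (J : finType) (B : {set J})
    (b : J -> R) (x : R) :
  2^-1 <= x -> x <= 1 -> (forall i, i \in B -> 0 <= b i <= x) ->
  1 <= \sum_(i in B) b i ->
  \sum_(i in B) b i ^+ 2
    <= x ^+ 2 + (1 - x) ^+ 2 + 2 * (\sum_(i in B) b i - 1).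
Proof.
move=> x_ge x_le bx S1.
case: (boolP [forall i in B, b i <= 2^-1]) => [/'forall_implyP small|].
  have : \sum_(i in B) b i ^+ 2 <= \sum_(i in B) b i * 2^-1.
    apply: ler_sum => i iB; rewrite expr2; apply: ler_wpM2l; last exact: small.
    by have /andP[] := bx i iB.
  rewrite -mulr_suml; nra.
rewrite negb_forall => /existsP[z]; rewrite negb_imply -ltNge => /andP[zB z_gt].
have /andP[_ zx] := bx z zB.
(* Doubled, this says that [b z ^+ 2 + (1 - b z) ^+ 2] is at most the same expression in [x]. *)
have z_le_x : 0 <= (x - b z) * (x + b z - 1) by apply: mulr_ge0; lra.
have splitB (f : J -> R) :
    \sum_(i in B) f i = f z + \sum_(i in B | i != z) f i by exact: bigD1.
move: S1; rewrite !splitB.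
set u := \sum_(i in B | i != z) b i => S1.
have u_ge0 : 0 <= u.
  by apply: sumr_ge0 => i /andP[iB _]; have /andP[] := bx i iB.
have others_le v : (forall i, i \in B -> i != z -> b i <= v) ->
    \sum_(i in B | i != z) b i ^+ 2 <= u * v.
  move=> bv; rewrite mulr_suml; apply: ler_sum => i /andP[iB iz].
  by rewrite expr2; apply: ler_wpM2l (bv i iB iz); have /andP[] := bx i iB.
have [u_le1|u_gt1] := leP u 1.
  have : \sum_(i in B | i != z) b i ^+ 2 <= u * u.
    apply: others_le => i iB iz; rewrite /u (bigD1 i) /=; last by rewrite iB.
    rewrite lerDl; apply: sumr_ge0 => j /andP[/andP[jB _] _].
    by have /andP[] := bx j jB.
  (* That is, [(u - 1) ^+ 2 <= b z ^+ 2], which is the claim with [b z] in place of [x]. *)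
  have : 0 <= (u + b z - 1) * (1 - u + b z) by apply: mulr_ge0; lra.
  nra.
have : \sum_(i in B | i != z) b i ^+ 2 <= u * 1.
  by apply: others_le => i iB _; have /andP[_ /le_trans->] := bx i iB.
nra.
Qed.

(** * Expectations over i.i.d. lists, and the second moment under perfect packing *)

Section Expect.

Context (R : realType) (F : discrete_distribution).
Local Notation p i := (ratr (item_prob (d := F) i) : R).

Lemma expect0 (f : seq rat -> R) : expect F 0 f = f [::].
Proof.
rewrite /expect (big_pred1 [tuple]) => [|w]; last first.
  by case: w => -[] //= sz0; apply/esym/eqP/val_inj.
by rewrite big_ord0 mul1r.
Qed.

Lemma expectS n (f : seq rat -> R) :
  expect F n.+1 f = \sum_i p i * expect F n (fun L => f (item_size i :: L)).
Proof.
rewrite /expect; under [RHS]eq_bigr => i _ do rewrite mulr_sumr.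
rewrite pair_big /=.
rewrite (reindex (fun iw : 'I_(nitems F) * n.-tuple 'I_(nitems F) =>
    [tuple of iw.1 :: iw.2])) /=; last first.
  exists (fun w => (thead w, [tuple of behead w])) => [[i w] _|w _].
    by congr (_, _); apply: val_inj.
  by rewrite -tuple_eta.
apply: eq_bigr => -[i w] _ /=; rewrite mulrA; congr (_ * _).
rewrite big_ord_recl; congr (_ * _).
by apply: eq_bigr => j _; rewrite tnthS.
Qed.

Lemma expect_lin n (a b : R) (f g : seq rat -> R) :
  expect F n (fun L => a * f L + b * g L) = a * expect F n f + b * expect F n g.
Proof.
rewrite /expect !mulr_sumr -big_split; apply: eq_bigr => w _ /=; ring.
Qed.

Lemma le_expect n (f g : seq rat -> R) :
  (forall w : seq 'I_(nitems F),
    f [seq item_size i | i <- w] <= g [seq item_size i | i <- w]) ->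
  expect F n f <= expect F n g.
Proof.
move=> fg; apply: ler_sum => w _; apply: ler_wpM2l => //.
by apply: prodr_ge0 => j _; rewrite ler0q ltW // item_prob_gt0.
Qed.

Lemma prob_ge0 i : 0 <= p i.
Proof. by rewrite ler0q ltW // item_prob_gt0. Qed.

Lemma prob_sum1 : \sum_i p i = 1.
Proof. by rewrite -rmorph_sum /= item_prob_sum1 rmorph1. Qed.

Lemma expect_cst n (a : R) : expect F n (fun=> a) = a.
Proof.
elim: n => [|n IH]; first by rewrite expect0.
rewrite expectS; under eq_bigr => i _ do rewrite IH.
by rewrite -mulr_suml prob_sum1 mul1r.
Qed.

Lemma expect_sum n (phi : rat -> R) :
  expect F n (fun L => \sum_(a <- L) phi a)
    = n%:R * \sum_i p i * phi (item_size i).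
Proof.
elim: n => [|n IH]; first by rewrite expect0 big_nil mul0r.
rewrite expectS -natr1 mulrDl mul1r -IH.
have -> : expect F n (fun L => \sum_(a <- L) phi a)
    = \sum_i p i * expect F n (fun L => \sum_(a <- L) phi a).
  by rewrite -mulr_suml prob_sum1 mul1r.
rewrite -big_split; apply: eq_bigr => i _ /=; rewrite -mulrDr; congr (_ * _).
rewrite addrC -[in RHS](expect_cst n (phi _)) -[X in _ = X + _]mul1r.
rewrite -[X in _ = _ + X]mul1r -expect_lin.
by congr expect; apply/funext => L; rewrite big_cons !mul1r.
Qed.

Definition mean_size : R := \sum_i p i * ratr (item_size i).
Definition second_moment_size : R := \sum_i p i * ratr (item_size i) ^+ 2.

Lemma size_itv i : 0 <= (ratr (item_size (d := F) i) : R) <= 1.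
Proof. by rewrite ler0q -[1](rmorph1 (@ratr R)) ler_rat item_size_itv. Qed.

Lemma expect_opt_le n : expect F n (fun L => (opt L)%:R) <= n%:R * mean_size.
Proof.
rewrite -(expect_sum n ratr); apply: le_expect => w.
rewrite -rmorph_sum; apply: opt_le_total_size => a /mapP[i _ ->].
by have /andP[] := item_size_itv i.
Qed.

Lemma mean_size_ge0 : 0 <= mean_size.
Proof.
by apply: sumr_ge0 => i _; rewrite mulr_ge0 ?prob_ge0 //; have /andP[] := size_itv i.
Qed.

Lemma second_moment_le_mean : second_moment_size <= mean_size.
Proof.
apply: ler_sum => i _; rewrite ler_wpM2l ?prob_ge0 //.
have := size_itv i; nra.
Qed.

(** With [c = x ^+ 2 + (1 - x) ^+ 2], the weight [(c + 2) * a - a ^+ 2] is at least 2 on every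
    covered bin. Averaging bounds [n%:R * (second_moment_size - c * mean_size)] by twice the
    expected waste, which is o(n). *)
Lemma perfect_packing_second_moment_le (x : R) :
  2^-1 <= x -> perfect_packing_upto x F ->
  second_moment_size <= (x ^+ 2 + (1 - x) ^+ 2) * mean_size.
Proof.
move=> x_ge [perfect max_le].
have mean0 := mean_size_ge0.
have mom_mean := second_moment_le_mean.
have [x_ge1|x_lt1] := leP 1 x.
  by apply: (le_trans mom_mean); rewrite ler_peMl //; nra.
set c := x ^+ 2 + (1 - x) ^+ 2.
have c_ge : 2^-1 <= c by have := sqr_ge0 (x - 2^-1); rewrite /c; lra.
have size_le i : ratr (item_size (d := F) i) <= x.
  apply: le_trans max_le; rewrite ler_rat; exact: le_bigmax.
have waste_ge n : n%:R * (second_moment_size - c * mean_size)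
    <= 2 * expect F n (fun L => ratr (total_size L) - (opt L)%:R).
  have -> : n%:R * (second_moment_size - c * mean_size)
      = 2 * (n%:R * mean_size) - n%:R * \sum_i p i *
          ((c + 2) * ratr (item_size i) - ratr (item_size i) ^+ 2).
    rewrite [X in _ = _ - _ * X](_ : _ = (c + 2) * mean_size - second_moment_size).
      by ring.
    by rewrite /mean_size mulr_sumr -sumrB; apply: eq_bigr => i _; ring.
  have -> : expect F n (fun L => ratr (total_size L) - (opt L)%:R)
      = n%:R * mean_size - expect F n (fun L => (opt L)%:R).
    rewrite -(expect_sum n ratr) -[X in _ = X - _]mul1r -[X in _ = _ + X]mulN1r.
    rewrite -expect_lin; congr expect; apply/funext => L.
    by rewrite /total_size rmorph_sum mul1r mulN1r.
  rewrite mulrBr lerD2l lerN2.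
  rewrite -(expect_sum n (fun a => (c + 2) * ratr a - ratr a ^+ 2)).
  have -> : 2 * expect F n (fun L => (opt L)%:R)
      = expect F n (fun L => (opt L)%:R * 2 :> R).
    rewrite -[LHS]addr0 -[X in _ + X = _](mul0r (expect F n (fun=> 0))) -expect_lin.
    by congr expect; apply/funext => L; ring.
  apply: le_expect => w; apply: opt_mul_le => [a /mapP[i _ ->]|B B1].
    by have /andP[s0 s1] := size_itv i; rewrite /= subr_ge0 expr2 ler_wpM2r //; lra.
  have bin_ge1 : 1 <= \sum_(i in B) ratr [seq item_size i | i <- w]`_i :> R.
    by rewrite -rmorph_sum /= -[1](rmorph1 (@ratr R)) ler_rat.
  rewrite sumrB -mulr_sumr.
  have := @sum_sqr_le_covered R _ B (fun i => ratr [seq item_size i | i <- w]`_i)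
    x x_ge (ltW x_lt1).
  move=> /(_ _ bin_ge1) => h; move: bin_ge1.
  have : \sum_(i in B) ratr [seq item_size i | i <- w]`_i ^+ 2
      <= c + 2 * (\sum_(i in B) ratr [seq item_size i | i <- w]`_i - 1).
    apply: h => i _.
    have /mapP[j _ ->] : [seq item_size i | i <- w]`_i
      \in [seq item_size i | i <- w] by exact: mem_nth.
    by rewrite size_le andbT; have /andP[] := size_itv j.
  nra.
(* One positive index [N.+1] with waste at most [e / 2] per item suffices, since [waste_ge] can be
   divided by it. *)
apply/ler_addgt0Pr => e e_gt0.
have e2_gt0 : 0 < e / 2 by lra.
move/eqoP : perfect => /(_ _ e2_gt0) [N _ HN].
have := HN N.+1 (leqnSn N); rewrite /= normr_nat => le_e.
have := waste_ge N.+1.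
have := le_trans (ler_norm _) le_e.
have : 0 < N.+1%:R :> R by [].
set n := N.+1%:R; set W := expect _ _ _ => n0 We nW.
have : n * (second_moment_size - c * mean_size) <= n * e by lra.
rewrite ler_pM2l //; lra.
Qed.

(** * Dual Next-Fit as a renewal process *)

Section DualNextFit.

Context (D : nat) (k : 'I_(nitems F) -> nat).
Hypothesis D_gt0 : (0 < D)%N.
Hypothesis size_eq : forall i, item_size i = (k i)%:R / D%:R.

Local Notation bin_length := (renewal (fun i => p i) k D).

Lemma prob_step_gt0 : 0 < mean_size -> 0 < \sum_(i | k i != 0%N) p i.
Proof.
move=> mean_gt0; apply: (lt_le_trans mean_gt0).
rewrite /mean_size (bigID (fun i => k i != 0%N)) /= [X in _ + X]big1 ?addr0.
  apply: ler_sum => i _; rewrite -[leRHS]mulr1 ler_wpM2l ?prob_ge0 //.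
  by have /andP[] := size_itv i.
by move=> i; rewrite negbK => /eqP k0; rewrite size_eq k0 mul0r rmorph0 mulr0.
Qed.

(** The bin still open after [n] draws would close after more than [n] draws; by Wald's identity its
    mean closing time is the mean time to close the initial bin plus [bin_length] per covered bin.
    The induction conditions on the first draw. *)
Lemma dnf_from_ge n l : 0 < mean_size -> (l < D)%N ->
  n%:R - renewal (fun i => p i) k (D - l)
    <= bin_length * expect F n (fun L => (dnf_from (l%:R / D%:R) L)%:R).
Proof.
move=> mean_gt0; have step_gt0 := prob_step_gt0 mean_gt0.
have D0 : D%:R != 0 :> rat by rewrite pnatr_eq0 -lt0n.
elim: n l => [|n IH] l lD.
  by rewrite expect0 mulr0 sub0r oppr_le0 renewal_ge0 // => [i|]; rewrite ?prob_ge0 ?prob_sum1.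
rewrite renewalE ?subn_gt0 ?prob_sum1 //.
have -> : n.+1%:R - (1 + \sum_i p i * renewal (fun i => p i) k (D - l - k i))
    = \sum_i p i * (n%:R - renewal (fun i => p i) k (D - l - k i)).
  under [RHS]eq_bigr => i _ do rewrite mulrBr.
  by rewrite sumrB -mulr_suml prob_sum1 -natr1; ring.
rewrite expectS mulr_sumr; apply: ler_sum => i _.
rewrite mulrCA ler_wpM2l ?prob_ge0 //= size_eq -mulrDl -natrD.
rewrite ler_pdivlMr ?ltr0n // mul1r ler_nat.
case: leqP => lk; last by rewrite -subnDA; exact: IH.
(* The draw closes the bin: nothing remains to wait for, and the restart at level 0 costs one
   [bin_length], paid by the newly covered bin. *)
have -> : (D - l - k i = 0)%N by lia.
have := IH 0%N D_gt0; rewrite subn0 mul0r renewal0 subr0.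
have -> : expect F n (fun L => (dnf_from 0 L).+1%:R)
    = 1 + expect F n (fun L => (dnf_from 0 L)%:R) :> R.
  rewrite -[X in _ = X + _](expect_cst n) -[X in _ = X + _]mul1r.
  rewrite -[X in _ = _ + X]mul1r -expect_lin; congr expect.
  by apply/funext => L; rewrite !mul1r nat1r.
lra.
Qed.

End DualNextFit.

(** Rational sizes lie on a lattice of step [1 / D], so the renewal theory over [nat] applies with
    level [D]. *)
Lemma common_denominator : exists (D : nat) (k : 'I_(nitems F) -> nat),
  (0 < D)%N /\ forall i, item_size i = (k i)%:R / D%:R.
Proof.
pose d i := `|denq (item_size (d := F) i)|%N.
have d_gt0 i : (0 < d i)%N by rewrite absz_gt0 denq_eq0.
exists (\prod_i d i)%N.
exists (fun i => `|numq (item_size i)| * \prod_(j | j != i) d j)%N.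
split=> [|i]; first by rewrite prodn_gt0.
have P0 : (\prod_(j | j != i) d j)%:R != 0 :> rat.
  by rewrite pnatr_eq0 -lt0n prodn_gt0.
have -> : (\prod_j d j = d i * \prod_(j | j != i) d j)%N by rewrite (bigD1 i).
rewrite !natrM -mulf_div divff // mulr1.
rewrite -{1}[item_size i]divq_num_den /d !natr_absz.
by rewrite !ger0_norm ?denq_ge0 // numq_ge0; have /andP[] := item_size_itv i.
Qed.

Lemma dnf_ge : 0 < mean_size -> exists M : R,
  [/\ 0 < M, M * mean_size <= 1 + second_moment_size / mean_size &
    forall n, n%:R - M <= M * expect F n (fun L => (dnf L)%:R)].
Proof.
move=> mean_gt0; have [D [k [D_gt0 size_eq]]] := common_denominator.
have step_gt0 := prob_step_gt0 size_eq mean_gt0.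
have D0 : 0 < D%:R :> R by rewrite ltr0n.
have kE i : (k i)%:R = D%:R * ratr (item_size i) :> R.
  by rewrite size_eq rmorphM fmorphV !rmorph_nat mulrC divfK // gt_eqF.
exists (renewal (fun i => p i) k D); split=> [||n].
- rewrite renewalE ?prob_sum1 //; apply: ltr_wpDr => //.
  apply: sumr_ge0 => i _; rewrite mulr_ge0 ?prob_ge0 // renewal_ge0 ?prob_sum1 // => j.
  exact: prob_ge0.
(* Lorden's bound is in units of [1 / D] and scales linearly, so [D] cancels. *)
- have := lorden prob_ge0 prob_sum1 step_gt0 D_gt0; rewrite /overshoot.
  have -> : \sum_i p i * (k i)%:R = D%:R * mean_size.
    by rewrite mulr_sumr; apply: eq_bigr => i _; rewrite kE; ring.
  have -> : \sum_i p i * (k i)%:R ^+ 2 = D%:R ^+ 2 * second_moment_size.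
    by rewrite mulr_sumr; apply: eq_bigr => i _; rewrite kE; ring.
  move=> /(_ (mulr_gt0 D0 mean_gt0)).
  have -> : D%:R ^+ 2 * second_moment_size / (D%:R * mean_size)
      = D%:R * (second_moment_size / mean_size).
    by field; rewrite !gt_eqF.
  move: (second_moment_size / mean_size) => q h.
  rewrite -(ler_pM2l D0); lra.
- by have := dnf_from_ge D_gt0 size_eq n mean_gt0 D_gt0; rewrite subn0 mul0r.
Qed.

End Expect.

(** * Passage to the lower limit *)

Lemma limn_einf_ge (R : realType) (u : nat -> R) (l : R) :
  (forall e, 0 < e -> \forall n \near \oo, l - e <= u n) ->
  (l%:E <= limn_einf (fun n => (u n)%:E))%E.
Proof.
move=> ul; apply/lee_addgt0Pr => e e_gt0; rewrite limn_einf_lim.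
rewrite -leeBlDr // -EFinB; apply: lime_ge; first exact: is_cvg_einfs.
have [N _ HN] := ul e e_gt0; exists N => // n /= Nn.
apply: le_ereal_inf_tmp => _ [m /= nm <-]; rewrite lee_fin; apply: HN => /=.
exact: leq_trans nm.
Qed.

Theorem theorem6 (R : realType) (x : R) (hx : 2^-1 <= x) :
  ((1 / (1 + x ^+ 2 + (1 - x) ^+ 2))%:E
    <= ereal_inf [set aecr_dnf R F | F in perfect_packing_upto x])%E.
Proof.
apply: le_ereal_inf_tmp => _ [F FP <-]; apply: limn_einf_ge => e e_gt0.
set c1 := 1 + x ^+ 2 + (1 - x) ^+ 2.
have c1_ge1 : 1 <= c1 by rewrite /c1 -addrA lerDl addr_ge0 ?sqr_ge0.
have c1_gt0 : 0 < c1 by lra.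
have q_le1 : 1 / c1 <= 1 by rewrite ler_pdivrMr // mul1r.
have e_opt_ge0 n : 0 <= expect F n (fun L => (opt L)%:R) :> R.
  by rewrite -(expect_cst F n (0 : R)); apply: le_expect.
have e_opt_le := expect_opt_le R F.
(* If the mean size is 0, the expected optimum is 0 and the ratio takes its default value 1, which
   is at least [1 / c1]. *)
have := mean_size_ge0 R F; rewrite le_eqVlt => /predU1P[mean0|mean_gt0].
  apply: nearW => n; rewrite /expected_ratio ifT; first by lra.
  by rewrite eq_le e_opt_ge0 andbT (le_trans (e_opt_le n)) // -mean0 mulr0.
have [M [M_gt0 M_le dnf_ge_n]] := dnf_ge mean_gt0.
have mom_le : second_moment_size R F / mean_size R F <= c1 - 1.
  rewrite ler_pdivrMr // (le_trans (perfect_packing_second_moment_le hx FP)) //.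
  by rewrite /c1; lra.
have Mc : 1 / c1 * (M * mean_size R F) <= 1.
  by rewrite mulrAC ler_pdivrMr // !mul1r; lra.
near=> n.
rewrite /expected_ratio; case: eqP => [_|/eqP e_opt_neq0]; first by lra.
rewrite ler_pdivlMr; last by rewrite lt0r e_opt_neq0 e_opt_ge0.
set V := expect F n (fun L => (dnf L)%:R); have V_ge0 : 0 <= V.
  by rewrite -(expect_cst F n (0 : R)); apply: le_expect.
(* The upper bound on the expected optimum can only be multiplied by a nonnegative factor. *)
have [a_le0|a_gt0] := leP (1 / c1 - e) 0.
  by apply: le_trans V_ge0; rewrite mulr_le0_ge0.
apply: (le_trans (ler_wpM2l (ltW a_gt0) (e_opt_le n))).
rewrite -(ler_pM2l M_gt0); apply: le_trans (dnf_ge_n n).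
(* For such [n] the slack [e] absorbs the loss of [M] due to the last, incomplete bin. *)
have en : (e * mean_size R F)^-1 <= n%:R by near: n; exact: nbhs_infty_ger.
have em : 0 < e * mean_size R F by rewrite mulr_gt0.
have {}en : M <= M * (n%:R * (e * mean_size R F)).
  by rewrite ler_peMr ?(ltW M_gt0) // -ler_pdivrMr // div1r.
have : n%:R * (1 / c1 * (M * mean_size R F)) <= n%:R * 1 by rewrite ler_wpM2l.
move: (1 / c1) => q; lra.
Unshelve. all: by end_near.
Qed.
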